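(* Let $S\subseteq\Sigma^n$ be a double-MDS-code. Then: (a) There exist an integer $k\in[n]$, a partition $\{K_1,\ldots,K_k\}$ of $[n]$ into nonempty sets with $n_j=|K_j|$, prime double-MDS-codes $S_j\subseteq\Sigma^{n_j}$ with $\bar 0=(0,\ldots,0)\in S_j$ ($j\in[k]$), and $\sigma_0\in\{0,1\}$ such that $$\chi_S(\bar x)=\bigoplus_{j=1}^k\chi_{S_j}(\bar x_{K_j})\oplus\sigma_0\qquad\text{for all }\bar x\in\Sigma^n,$$ and this representation is unique: the number $k$, the partition $\{K_1,\ldots,K_k\}$ together with the codes $S_j$ attached to its blocks, and the constant $\sigma_0$ are uniquely determined by $S$. (b) $S$ is the union of $2^{k-1}$ pairwise disjoint prime double-codes of equal cardinality, and $\Sigma^n\setminus S$ is likewise the union of $2^{k-1}$ pairwise disjoint prime double-codes of equal cardinality. Equivalently, each of $G(S)$ and $G(\Sigma^n\setminus S)$ has exactly $2^{k-1}$ connected components, all of the same size. (c) If $k\ge 2$ and $G(S)$ is bipartite, then for every $j\in[k]$ the graphs $G(S_j)$ and $G(\Sigma^{n_j}\setminus S_j)$ are bipartite.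
   Context: Let $\Sigma=\{0,1,2,3\}$ and $[n]=\{1,\ldots,n\}$. An $i$-line of $\Sigma^n$ is a set of the four words that agree in all coordinates except the $i$th; a line is an $i$-line for some $i\in[n]$. A set $S\subseteq\Sigma^n$ is a double-code if every line contains either $0$ or $2$ elements of $S$, and a double-MDS-code if every line contains exactly $2$ elements of $S$. A double-code is complementable if it is contained in some double-MDS-code, and prime if it is complementable, nonempty, and cannot be partitioned into two or more nonempty double-codes. The adjacency graph $G(S)$ of $S\subseteq\Sigma^n$ has vertex set $S$, two vertices being adjacent iff they differ in exactly one coordinate. $\chi_S:\Sigma^n\to\{0,1\}$ is the characteristic function of $S$ and $\oplus$ is addition modulo $2$. For $K=\{i_1<\cdots<i_m\}\subseteq[n]$ and $\bar x=(x_1,\ldots,x_n)$, write $\bar x_K=(x_{i_1},\ldots,x_{i_m})$. *)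

(* Defs.v *)
From mathcomp Require Import all_boot.
Set Implicit Arguments. Unset Strict Implicit. Unset Printing Implicit Defensive.

(* Sigma = {0,1,2,3} = 'I_4 ; words indexed by a finite coordinate type I.
   Sigma^n is word 'I_n. *)
Definition word (I : finType) := {ffun I -> 'I_4}.

Definition line (I : finType) (x : word I) (i : I) : {set word I} :=
  [set y : word I | [forall j : I, (j != i) ==> (y j == x j)]].

Definition double_code (I : finType) (S : {set word I}) : Prop :=
  forall (x : word I) (i : I),
    #|line x i :&: S| = 0 \/ #|line x i :&: S| = 2.

Definition double_MDS (I : finType) (S : {set word I}) : Prop :=
  forall (x : word I) (i : I), #|line x i :&: S| = 2.

Definition complementable (I : finType) (S : {set word I}) : Prop :=
  exists M : {set word I}, double_MDS M /\ S \subset M.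

(* prime: a complementable nonempty double-code which cannot be partitioned
   into two or more nonempty double-codes ([partition P S] excludes set0). *)
Definition prime_code (I : finType) (S : {set word I}) : Prop :=
  [/\ double_code S, complementable S, S != set0 &
    ~ exists P : {set {set word I}},
        [/\ partition P S, 2 <= #|P| & forall C, C \in P -> double_code C]].

Definition adjacent (I : finType) (x y : word I) : bool :=
  #|[set i : I | x i != y i]| == 1.

Definition gadj (I : finType) (S : {set word I}) : rel (word I) :=
  fun x y => [&& x \in S, y \in S & adjacent x y].

Definition component (I : finType) (S : {set word I}) (x : word I) : {set word I} :=
  [set y | connect (gadj S) x y].

Definition components (I : finType) (S : {set word I}) : {set {set word I}} :=
  [set component S x | x in S].

Definition bipartite (I : finType) (S : {set word I}) : Prop :=
  exists f : word I -> bool,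
    forall x y, x \in S -> y \in S -> adjacent x y -> f x != f y.

Definition zero_word (m : nat) : word 'I_m := [ffun _ => ord0].

(* x_K : the subword of x on the coordinates of K, in increasing order *)
Definition restr (n : nat) (K : {set 'I_n}) (x : word 'I_n) : word 'I_#|K| :=
  [ffun i : 'I_#|K| => x (enum_val i)].

Definition ord_partition (n k : nat) (K : 'I_k -> {set 'I_n}) : Prop :=
  [/\ forall j, K j != set0,
      forall j j', j != j' -> [disjoint K j & K j'] &
      forall i : 'I_n, exists j, i \in K j].

Definition representation (n : nat) (S : {set word 'I_n}) (k : nat)
    (K : 'I_k -> {set 'I_n}) (Sc : forall j : 'I_k, {set word 'I_#|K j|})
    (s : bool) : Prop :=
  [/\ 1 <= k <= n, ord_partition K,
      forall j, double_MDS (Sc j) /\ prime_code (Sc j),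
      forall j, zero_word #|K j| \in Sc j &
      forall x : word 'I_n,
        (x \in S) = addb (\big[addb/false]_(j < k) (restr (K j) x \in Sc j)) s].

Definition prime_split (I : finType) (S : {set word I}) (m : nat) : Prop :=
  exists P : {set {set word I}},
    [/\ partition P S, #|P| = m,
        forall C, C \in P -> prime_code C &
        forall C D, C \in P -> D \in P -> #|C| = #|D|].

Definition equal_components (I : finType) (S : {set word I}) (m : nat) : Prop :=
  #|components S| = m /\
  forall C D, C \in components S -> D \in components S -> #|C| = #|D|.

(* Main.v *)
Require Import Defs.
From mathcomp Require Import all_boot.
Set Implicit Arguments. Unset Strict Implicit. Unset Printing Implicit Defensive.

(* Colour a word by its membership in S, and call two words connected if they
   are joined by a path of lines along which the colour is constant; the classes
   are the components of G(S) and of its complement.  For each direction i, the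
   words of the i-line of x with the colour opposite to that of x all lie in one
   class, and this class depends only on the class of x: two 2-subsets of a
   3-element set meet.  So each i induces an involution tau_i of the set of
   classes; these involutions commute, and any two classes are exchanged by a
   product of them.  Hence tau_i and tau_j agree everywhere as soon as they agree
   on one class.  If they differ, the change of the colour along an i-line does
   not depend on x_j.  The blocks of the decomposition are therefore the classes
   of the relation tau_i = tau_j, each block code is connected because an even
   number of equal involutions cancels, and every representation must have these
   blocks.  A component of G(S) is then the set of words with given colours in
   all blocks. *)

(** * Paths in finite relations *)

Lemma connect_homo (T U : finType) (e : rel T) (e' : rel U) (g : T -> U) :
  (forall x y, e x y -> connect e' (g x) (g y)) ->
  forall x y, connect e x y -> connect e' (g x) (g y).
Proof.
move=> eg x y /connectP[p]; elim: p x => [|z p IHp] x /=; first by move=> _ ->.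
by case/andP=> /eg exz /IHp/[apply]; exact: connect_trans.
Qed.

Lemma connect_invariant (T : finType) (U : Type) (e : rel T) (h : T -> U) :
  (forall x y, e x y -> h x = h y) -> forall x y, connect e x y -> h x = h y.
Proof.
move=> eh x y /connectP[p]; elim: p x => [|z p IHp] x /=; first by move=> _ ->.
by case/andP=> /eh-> /IHp/[apply].
Qed.

Definition upd (I : finType) (x : word I) (i : I) (a : 'I_4) : word I :=
  [ffun j => if j == i then a else x j].

(** * Colour classes and the involutions tau *)

Section Words.
Context (I : finType).
Implicit Types (x y z : word I) (i j : I) (a b : 'I_4) (S : {set word I}).

Lemma updE x i a j : upd x i a j = if j == i then a else x j.
Proof. by rewrite ffunE. Qed.

Lemma upd_id x i : upd x i (x i) = x.
Proof. by apply/ffunP=> j; rewrite updE; case: eqP => // ->. Qed.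

Lemma upd_upd x i a b : upd (upd x i a) i b = upd x i b.
Proof. by apply/ffunP=> j; rewrite !updE; case: eqP. Qed.

Lemma updC x i j a b : i != j -> upd (upd x i a) j b = upd (upd x j b) i a.
Proof.
move=> nij; apply/ffunP=> l; rewrite !updE.
by case: (eqVneq l j) => // ->; rewrite eq_sym (negbTE nij).
Qed.

Lemma upd_back x i a : upd (upd x i a) i (x i) = x.
Proof. by rewrite upd_upd upd_id. Qed.

(** The words [w s], equal to [y] on [s] and to [x] elsewhere, lead from [x] to [y] by one-letter
    changes, and only those at coordinates in [A] can alter anything. *)
Lemma word_ind_on (A : {set I}) (P : word I -> Prop) x :
  P x -> (forall z i a, i \in A -> P z -> P (upd z i a)) ->
  forall y, (forall i, i \notin A -> y i = x i) -> P y.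
Proof.
move=> Px IH y yx; pose w (s : seq I) : word I :=
  [ffun i => if i \in s then y i else x i].
have -> : y = w (enum I) by apply/ffunP=> i; rewrite ffunE mem_enum.
elim: (enum I) => [|i s IHs].
  by have -> : w [::] = x by apply/ffunP=> i; rewrite ffunE.
have -> : w (i :: s) = upd (w s) i (y i).
  by apply/ffunP=> j; rewrite updE !ffunE inE; case: eqP => //= ->.
case: (boolP (i \in A)) => [|/yx yi]; first by move/IH; apply.
suff -> : y i = w s i by rewrite upd_id.
by rewrite ffunE yi if_same.
Qed.

Lemma mem_lineP x i y : reflect (exists a, y = upd x i a) (y \in line x i).
Proof.
rewrite inE; apply: (iffP forallP) => [xy | [a ->] j].
  exists (y i); apply/ffunP=> j; rewrite updE; case: eqVneq => [-> //|nji].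
  by move/(_ j): xy; rewrite nji => /eqP.
by rewrite updE; case: eqP => //= _; rewrite eqxx.
Qed.

Lemma upd_inj x i : injective (upd x i).
Proof. by move=> a b /ffunP/(_ i); rewrite !updE eqxx. Qed.

Lemma card_line_setI S x i :
  #|line x i :&: S| = #|[set a | upd x i a \in S]|.
Proof.
rewrite -(card_imset _ (@upd_inj x i)); apply: eq_card => y.
apply/setIP/imsetP => [[/mem_lineP[a ->] Sy]|[a]]; first by exists a; rewrite ?inE.
by rewrite inE => Sa ->; split=> //; apply/mem_lineP; exists a.
Qed.

Lemma card_line x i : #|line x i| = 4.
Proof.
rewrite -[line x i]setIT card_line_setI -[RHS]card_ord.
by apply: eq_card => a; rewrite !inE.
Qed.

Lemma double_MDSP S :
  double_MDS S <-> forall x i, #|[set a | upd x i a \in S]| = 2.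
Proof. by split=> H x i; rewrite ?card_line_setI // -card_line_setI. Qed.

Lemma double_MDS_setC S : double_MDS S -> double_MDS (~: S).
Proof.
move=> mS x i; have := cardsID S (line x i).
by rewrite mS card_line setDE => -[].
Qed.

Lemma double_MDS_color S (c : bool) x i :
  double_MDS S -> #|[set a | (upd x i a \in S) == c]| = 2.
Proof.
case: c => mS; last move/double_MDS_setC: mS => mS.
  rewrite -[RHS](mS x i) card_line_setI.
  by apply: eq_card => a; rewrite !inE eqb_id.
rewrite -[RHS](mS x i) card_line_setI.
by apply: eq_card => a; rewrite !inE eqbF_neg.
Qed.

(* The two values of the colour opposite to that of [x] and the two of the
   colour opposite to that of [y] all lie among the three letters other
   than [x i]. *)
Lemma common_flip S x y i : double_MDS S -> x i = y i ->
  exists a, (upd x i a \in S) = (x \notin S) /\ (upd y i a \in S) = (y \notin S).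
Proof.
move=> mS xy; pose A z := [set a | (upd z i a \in S) == (z \notin S)].
have Ai z : z i \notin A z by rewrite inE upd_id; case: (_ \in _).
have : A x :&: A y != set0.
  apply: contra_eq_neq (cardsUI (A x) (A y)) => ->.
  rewrite cards0 !double_MDS_color // addn0 neq_ltn.
  suff /subset_leq_card : A x :|: A y \subset [set~ x i].
    by rewrite cardsC1 card_ord ltnS => ->.
  apply/subsetP=> a; rewrite in_setU in_setC1; case/orP=> Aa.
    by apply: contraNneq (Ai x) => <-.
  by rewrite xy; apply: contraNneq (Ai y) => <-.
by case/set0Pn=> a /setIP[]; rewrite !inE => /eqP ? /eqP ?; exists a.
Qed.

(** One relation serves both colours, because [tau] exchanges them. The trivial step [a = x i] is
    allowed. *)
Definition link S : rel (word I) := fun x y =>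
  [exists i, exists a, y == upd x i a] && ((x \in S) == (y \in S)).

Definition conn S : rel (word I) := connect (link S).

Lemma linkP S x y :
  reflect (exists i a, y = upd x i a /\ (x \in S) = (y \in S)) (link S x y).
Proof.
apply: (iffP andP) => [[/existsP[i /existsP[a /eqP yE]] /eqP Sxy]|[i [a [yE Sxy]]]].
  by exists i, a.
by split; [apply/existsP; exists i; apply/existsP; exists a; apply/eqP | apply/eqP].
Qed.

Lemma link_sym S : symmetric (link S).
Proof.
suff H x y : link S x y -> link S y x by move=> x y; apply/idP/idP; apply: H.
by case/linkP=> i [a [-> Sxy]]; apply/linkP; exists i, (x i); rewrite upd_back.
Qed.

Lemma conn_sym S x y : conn S x y = conn S y x.
Proof. exact/sym_connect_sym/link_sym. Qed.

Lemma conn_trans S : transitive (conn S).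
Proof. exact: connect_trans. Qed.

Lemma conn_refl S x : conn S x x.
Proof. exact: connect0. Qed.

Lemma conn_mem S x y : conn S x y -> (x \in S) = (y \in S).
Proof. by apply: connect_invariant => {}x {}y /linkP[i [a []]]. Qed.

Lemma conn_upd S x i a : (upd x i a \in S) = (x \in S) -> conn S x (upd x i a).
Proof. by move=> Sa; apply/connect1/linkP; exists i, a. Qed.

(* The default value is never used when [S] is a double-MDS-code, and which
   letter is picked does not matter up to [conn] (see [conn_tau_upd]). *)
Definition tau S i x : word I :=
  upd x i (odflt (x i) [pick a | (upd x i a \in S) == (x \notin S)]).

Lemma tau_mem S i x : double_MDS S -> (tau S i x \in S) = (x \notin S).
Proof.
move=> mS; rewrite /tau; case: pickP => [a /eqP //|Sx].
by have [a [/eqP]] := common_flip mS (erefl (x i)); rewrite Sx.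
Qed.

Lemma tau_out S i x j : j != i -> tau S i x j = x j.
Proof. by rewrite updE => /negbTE->. Qed.

Lemma tauE S i x : exists a, tau S i x = upd x i a.
Proof. by eexists. Qed.

Lemma conn_tau_upd S i x a : double_MDS S ->
  (upd x i a \in S) = (x \notin S) -> conn S (tau S i x) (upd x i a).
Proof.
move=> mS Sa; have [b xb] := tauE S i x.
rewrite -(upd_upd x i b) -xb; apply: conn_upd.
by rewrite xb upd_upd -xb Sa tau_mem.
Qed.

(** If a link has direction [i], its ends share their [i]-line. Otherwise one letter flips both ends
    at [i], and the two flipped words are again linked in direction [j]. Hence [tau S i] acts on
    classes. *)
Lemma conn_tau S i x y : double_MDS S ->
  conn S x y -> conn S (tau S i x) (tau S i y).
Proof.
move=> mS; apply: connect_homo => {}x {}y /linkP[j [b [yE Sxy]]].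
have [ij|nij] := eqVneq i j.
  have [a yt] := tauE S i y.
  have yxt : tau S i y = upd x i a by rewrite yt yE ij upd_upd.
  by rewrite -/(conn S) yxt; apply: conn_tau_upd => //; rewrite -yxt tau_mem ?Sxy.
have [|a [xa ya]] := @common_flip S x y i mS; first by rewrite yE updE (negbTE nij).
apply: conn_trans (conn_tau_upd mS xa) _.
rewrite conn_sym; apply: conn_trans (conn_tau_upd mS ya) _.
rewrite conn_sym yE updC 1?eq_sym //; apply: conn_upd.
by rewrite updC // -yE ya xa Sxy.
Qed.

Lemma tauK S i x : double_MDS S -> conn S (tau S i (tau S i x)) x.
Proof.
move=> mS; have [a xa] := tauE S i x.
rewrite -[X in conn S _ X](upd_back x i a) -xa; apply: conn_tau_upd => //.
by rewrite tau_mem // negbK xa upd_back.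
Qed.

(** A letter [b] that flips both [x] and [tau S i x] in direction [j] completes a square whose
    fourth corner lies in both classes. *)
Lemma tauC S i j x : double_MDS S ->
  conn S (tau S i (tau S j x)) (tau S j (tau S i x)).
Proof.
move=> mS; have [->|nij] := eqVneq i j; first exact: conn_refl.
have [a xa] := tauE S i x.
have [|b [xb yb]] := @common_flip S x (tau S i x) j mS.
  by rewrite tau_out // eq_sym.
rewrite conn_sym; apply: conn_trans (conn_tau_upd mS yb) _.
rewrite xa updC //.
have xbS := conn_tau_upd mS xb.
rewrite conn_sym; apply: conn_trans (conn_tau i mS xbS) _.
apply: conn_tau_upd => //.
by rewrite -updC // -xa yb xb tau_mem // negbK.
Qed.

(** * Directions that induce the same involution *)

Definition equiflip S i j : bool := [forall x, conn S (tau S i x) (tau S j x)].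

Lemma equiflipP S i j :
  reflect (forall x, conn S (tau S i x) (tau S j x)) (equiflip S i j).
Proof. exact: forallP. Qed.

Lemma equiflip_refl S i : equiflip S i i.
Proof. by apply/equiflipP=> x; apply: conn_refl. Qed.

Lemma equiflip_sym S i j : equiflip S i j = equiflip S j i.
Proof. by apply/equiflipP/equiflipP=> ij x; rewrite conn_sym. Qed.

Lemma equiflip_trans S : transitive (equiflip S).
Proof.
move=> j i l /equiflipP ij /equiflipP jl; apply/equiflipP=> x.
by apply: conn_trans (jl x).
Qed.

(** One-letter changes lead from [x] to every word. Such a change either keeps the class or applies
    some [tau S l] to it, and [tau S l] commutes with both involutions, so the agreement at [x]
    spreads. *)
Lemma conn_tau_equiflip S i j x : double_MDS S ->
  conn S (tau S i x) (tau S j x) -> equiflip S i j.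
Proof.
move=> mS xij; apply/equiflipP=> y.
apply: (@word_ind_on setT (fun z => conn S (tau S i z) (tau S j z)) x) => //;
  last by move=> l; rewrite inE.
move=> z l a _ zij.
have moved w : conn S z w -> conn S (tau S i w) (tau S j w).
  move=> zw; rewrite conn_sym in zw.
  apply: conn_trans (conn_tau i mS zw) _; apply: conn_trans zij _.
  by rewrite conn_sym; apply: conn_tau.
case: (eqVneq (upd z l a \in S) (z \in S)) => [/conn_upd/moved // | nS].
have {}nS : (upd z l a \in S) = (z \notin S) by move: nS; do 2!case: (_ \in _).
have zl := conn_tau_upd mS nS; have lz := zl; rewrite conn_sym in lz.
apply: conn_trans (conn_tau i mS lz) _; apply: conn_trans (tauC i l z mS) _.
apply: conn_trans (conn_tau l mS zij) _; apply: conn_trans (tauC l j z mS) _.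
exact: conn_tau.
Qed.

(** The square has three corners of one colour. The opposite corner is in the class of [x], and the
    odd corner [upd x j b] is a flip of [x] along [j] and of the opposite corner along [i]. *)
Lemma equiflip_of_corner S i j x a b : double_MDS S -> i != j ->
  (upd x i a \in S) = (x \in S) -> (upd x j b \in S) = (x \notin S) ->
  (upd (upd x i a) j b \in S) = (x \in S) -> equiflip S i j.
Proof.
move=> mS nij xa xb xab; apply: (@conn_tau_equiflip _ _ _ x) => //.
have xr : conn S x (upd (upd x i a) j b).
  by apply: conn_trans (conn_upd xa) (conn_upd _); rewrite xab xa.
apply: conn_trans (conn_tau i mS xr) _; rewrite conn_sym.
apply: conn_trans (conn_tau_upd mS xb) _; rewrite conn_sym.
have xE : upd x j b = upd (upd (upd x i a) j b) i (x i).
  by rewrite (updC x a b nij) upd_upd -(updC x _ b nij) upd_id.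
by rewrite xE; apply: conn_tau_upd; rewrite // -xE xab xb.
Qed.

(** If one [i]-edge of a square kept its colour and the parallel one did not, exactly one corner
    would be odd, which [equiflip_of_corner] excludes. *)
Lemma derivative_upd S i j x a b : double_MDS S -> ~~ equiflip S i j ->
  (upd (upd x j b) i a \in S) (+) (upd x j b \in S) =
  (upd x i a \in S) (+) (x \in S).
Proof.
move=> mS nsij; have nij : i != j by apply: contraNneq nsij => ->; apply: equiflip_refl.
have H y c : (upd y i a \in S) = (y \in S) ->
    (upd (upd y j c) i a \in S) = (upd y j c \in S).
  move=> ya; rewrite -updC //; apply/eqP; apply: contraNT nsij => nS.
  (* The odd corner is [upd y j c] or the corner beyond it; in the second case the square is read
     from [upd y i a]. *)
  have [yc|yc] := eqVneq (upd y j c \in S) (y \in S); last first.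
    by apply: (@equiflip_of_corner _ _ _ y a c) => //;
      move: nS yc; case: (_ \in _); case: (_ \in _); case: (_ \in _).
  apply: (@equiflip_of_corner _ _ _ (upd y i a) (y i) c); rewrite ?upd_back // ?ya //.
  by move: nS; rewrite yc; do 2!case: (_ \in _).
have [xa|xa] := eqVneq (upd x i a \in S) (x \in S); first by rewrite H // xa !addbb.
have [xba|] := eqVneq (upd (upd x j b) i a \in S) (upd x j b \in S).
  by have := H _ (x j) xba; rewrite upd_back => E; rewrite E eqxx in xa.
by move: xa; do 4!case: (_ \in _).
Qed.

Lemma derivative_equiflip S i x y a : double_MDS S ->
  (forall l, equiflip S i l -> x l = y l) ->
  (upd x i a \in S) (+) (x \in S) = (upd y i a \in S) (+) (y \in S).
Proof.
move=> mS xy; apply: (@word_ind_on [set l | ~~ equiflip S i l] (fun z =>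
  (upd z i a \in S) (+) (z \in S) = (upd y i a \in S) (+) (y \in S)) y) => //.
  by move=> z l b; rewrite inE => nsil <-; apply: derivative_upd.
by move=> l; rewrite inE negbK => /xy.
Qed.

End Words.

(** * Components and prime codes *)

Section Components.
Context (I : finType).
Implicit Types (x y z : word I) (i : I) (a : 'I_4) (S C : {set word I}).

Lemma adjacentP x y :
  reflect (exists i a, a != x i /\ y = upd x i a) (adjacent x y).
Proof.
apply: (iffP cards1P) => [[i xyi]|[i [a [nax ->]]]].
  have xy j : (x j != y j) = (j == i) by move/setP/(_ j): xyi; rewrite !inE.
  exists i, (y i); split; first by rewrite eq_sym xy.
  apply/ffunP=> j; rewrite updE; case: (eqVneq j i) => [-> //|nji].
  by move: (xy j); rewrite (negbTE nji) => /negbFE/eqP.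
exists i; apply/setP=> j; rewrite !inE updE; case: (eqVneq j i) => [->|_].
  by rewrite eq_sym.
by rewrite eqxx.
Qed.

Lemma connect_gadj S x y : x \in S -> connect (gadj S) x y = conn S x y.
Proof.
move=> Sx; apply/idP/idP.
  apply: connect_sub => {Sx}x {}y /and3P[Sx Sy /adjacentP[i [a [_ yE]]]].
  by apply/connect1/linkP; exists i, a; rewrite Sx Sy.
case/connectP=> p; elim: p x Sx => [|z p IHp] x Sx /=; first by move=> _ ->.
case/andP=> /linkP[i [a [zE Sxz]]] zp yE.
have Sz : z \in S by rewrite -Sxz.
apply: connect_trans (IHp z Sz zp yE).
have [ax|nax] := eqVneq a (x i); first by rewrite zE ax upd_id connect0.
by apply: connect1; rewrite /gadj Sx Sz; apply/adjacentP; exists i, a.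
Qed.

Lemma mem_component S x y : x \in S -> (y \in component S x) = conn S x y.
Proof. by move=> Sx; rewrite inE connect_gadj. Qed.

Lemma component_sub S x : x \in S -> component S x \subset S.
Proof. by move=> Sx; apply/subsetP=> y; rewrite mem_component // => /conn_mem <-. Qed.

Lemma components_partition S : partition (components S) S.
Proof.
have -> : components S = equivalence_partition (conn S) S.
  apply: eq_in_imset => x Sx; apply/setP=> y.
  rewrite mem_component // !inE; case: (boolP (conn S x y)) => [/conn_mem <-|].
    by rewrite Sx.
  by rewrite andbF.
apply: equivalence_partitionP => x y z _ _ _; split; first exact: conn_refl.
move=> xy; apply/idP/idP; last exact: conn_trans.
by apply: conn_trans; rewrite conn_sym.
Qed.

(** On each line that it meets, [C] has two words, hence all the words of [S] on that line. So [C]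
    is a union of components. *)
Lemma double_code_closed S C x y : double_MDS S -> double_code C -> C \subset S ->
  conn S x y -> (x \in C) = (y \in C).
Proof.
move=> mS dC sCS; apply: connect_invariant => {}x {}y.
suff H z w : link S z w -> z \in C -> w \in C.
  by move=> xy; apply/idP/idP; apply: H; rewrite // link_sym.
case/linkP=> i [a [wE Szw]] Cz.
have Sz := subsetP sCS z Cz.
have zl : z \in line z i by apply/mem_lineP; exists (z i); rewrite upd_id.
have : line z i :&: C == line z i :&: S.
  rewrite eqEcard setIS // mS.
  case: (dC z i) => [/eqP|-> //]; rewrite cards_eq0 => /eqP/setP/(_ z).
  by rewrite in_setI zl Cz inE.
have wl : w \in line z i by apply/mem_lineP; exists a.
by move/eqP/setP/(_ w); rewrite !in_setI -Szw Sz wl.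
Qed.

Lemma component_double_code S x : double_MDS S -> x \in S ->
  double_code (component S x).
Proof.
move=> mS Sx z i.
have [->|[w]] := set_0Vmem (line z i :&: component S x); first by left; rewrite cards0.
case/setIP=> /mem_lineP[b wE]; rewrite mem_component // => xw; right.
rewrite -[RHS](mS z i); apply: eq_card => y; rewrite !in_setI mem_component //.
apply: andb_id2l => /mem_lineP[a yE]; apply/idP/idP => [/conn_mem <- //|Sy].
apply: conn_trans (xw) _; have -> : y = upd w i a by rewrite wE upd_upd -yE.
by apply: conn_upd; rewrite wE upd_upd -yE -wE -(conn_mem xw) Sx Sy.
Qed.

(** Every part of a partition into double-codes is closed under [conn], hence contains [x]; two
    distinct parts could not be disjoint. *)
Lemma prime_component S x : double_MDS S -> x \in S -> prime_code (component S x).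
Proof.
move=> mS Sx; have sub := component_sub Sx; split.
- exact: component_double_code.
- by exists S.
- by apply/set0Pn; exists x; rewrite mem_component // conn_refl.
case=> P [/and3P[/eqP cP tP nP] P2 dP].
have full C : C \in P -> x \in C.
  move=> PC; have sC : C \subset component S x.
    by rewrite -cP; apply: bigcup_sup.
  have /set0Pn[y Cy] : C != set0 by apply: contraNneq nP => <-.
  rewrite (double_code_closed (y := y) mS (dP C PC)) ?(subset_trans sC) //.
  by rewrite -mem_component //; apply: subsetP Cy.
case/card_gt1P: P2 => C [D [PC PD nCD]].
move/trivIsetP/(_ C D PC PD nCD)/pred0P/(_ x): tP.
by rewrite /= !full.
Qed.

Lemma prime_conn S x y : double_MDS S -> prime_code S ->
  x \in S -> y \in S -> conn S x y.
Proof.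
move=> mS [_ _ _ nP] Sx Sy; rewrite -mem_component //.
have -> : component S x = component S y; last by rewrite mem_component // conn_refl.
apply/eqP; apply: contra_notT nP => nxy; exists (components S).
split; first exact: components_partition.
  by apply/card_gt1P; exists (component S x), (component S y); rewrite ?imset_f.
by move=> C /imsetP[z Sz ->]; apply: component_double_code.
Qed.

(** Two words outside [S] are carried into [S] by [tau S i], joined there, and carried back. *)
Lemma prime_conn_color S x y i : double_MDS S -> prime_code S ->
  (x \in S) = (y \in S) -> conn S x y.
Proof.
move=> mS pS; case: (boolP (y \in S)) => Sy Sx; first exact: prime_conn.
apply: conn_trans (tauK i y mS); rewrite conn_sym.
apply: conn_trans (tauK i x mS); rewrite conn_sym.
by apply: conn_tau; rewrite // prime_conn // tau_mem // ?Sx.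
Qed.

Lemma conn_prime S x : double_MDS S -> x \in S ->
  (forall y, y \in S -> conn S x y) -> prime_code S.
Proof.
move=> mS Sx cS; suff <- : component S x = S by apply: prime_component.
apply/setP=> y; rewrite mem_component //.
by apply/idP/idP => [/conn_mem <-|/cS].
Qed.

(** Double counting: each word of [C] lies on the [i]-line of exactly four words [x]. *)
Lemma eq_card_lines (A B : {set word I}) i :
  (forall x, #|line x i :&: A| = #|line x i :&: B|) -> #|A| = #|B|.
Proof.
move=> AB.
have lsym x y : (x \in line y i) = (y \in line x i).
  by apply/mem_lineP/mem_lineP => -[a ->];
    [exists (y i) | exists (x i)]; rewrite upd_back.
suff E (C : {set word I}) : \sum_x #|line x i :&: C| = #|C| * 4.
  apply/eqP; rewrite -(@eqn_pmul2r 4) // -!E; apply/eqP.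
  by apply: eq_bigr => x _; apply: AB.
rewrite (eq_bigr (fun x => \sum_(y in C | y \in line x i) 1)); last first.
  by move=> x _; rewrite -sum1_card; apply: eq_bigl => y; rewrite in_setI andbC.
rewrite (exchange_big_dep (mem C)) /=; last by move=> x y _ /andP[].
rewrite -sum_nat_const; apply: eq_bigr => y Cy.
rewrite -[RHS](card_line y i) -[RHS]sum1_card; apply: eq_bigl => x.
by rewrite Cy lsym.
Qed.

End Components.

(** * Subwords *)

Section Blocks.
Context (n : nat).
Implicit Types (x y z : word 'I_n) (K : {set 'I_n}).

(** The rank of [i] in [K] is found by search, so that no proof of [i \in K] enters the term. *)
Definition glue K (u : word 'I_#|K|) z : word 'I_n :=
  [ffun i => if [pick r : 'I_#|K| | enum_val r == i] is Some r then u r else z i].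

Lemma glue_in K u z r : @glue K u z (enum_val r) = u r.
Proof.
rewrite ffunE; case: pickP => [q /eqP/enum_val_inj -> //|/(_ r)].
by rewrite eqxx.
Qed.

Lemma glue_out K u z i : i \notin K -> @glue K u z i = z i.
Proof.
move=> nKi; rewrite ffunE; case: pickP => // r /eqP ri.
by rewrite -ri enum_valP in nKi.
Qed.

Lemma enum_val_surj K i : i \in K -> exists r : 'I_#|K|, i = enum_val r.
Proof. by move=> Ki; exists (enum_rank_in Ki i); rewrite enum_rankK_in. Qed.

Lemma restr_glue K u z : restr K (glue u z) = u.
Proof. by apply/ffunP=> r; rewrite ffunE glue_in. Qed.

Lemma eq_restr K x y : (forall i, i \in K -> x i = y i) -> restr K x = restr K y.
Proof. by move=> xy; apply/ffunP=> r; rewrite !ffunE xy ?enum_valP. Qed.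

Lemma glue_restr K x y z : (forall i, i \in K -> x i = y i) ->
  (forall i, i \notin K -> z i = y i) -> glue (restr K x) z = y.
Proof.
move=> xy zy; apply/ffunP=> i; case: (boolP (i \in K)) => Ki.
  by have [r ri] := enum_val_surj Ki; rewrite -xy // ri glue_in ffunE.
by rewrite glue_out // zy.
Qed.

Lemma glue_upd K (u : word 'I_#|K|) r a z :
  glue (upd u r a) z = upd (glue u z) (enum_val r) a.
Proof.
apply/ffunP=> i; rewrite updE; case: (boolP (i \in K)) => Ki.
  have [q qi] := enum_val_surj Ki.
  by rewrite qi !glue_in updE (inj_eq enum_val_inj).
rewrite !glue_out //; case: eqP => // ir.
by rewrite ir enum_valP in Ki.
Qed.

Lemma restr_upd_in K x (r : 'I_#|K|) a :
  restr K (upd x (enum_val r) a) = upd (restr K x) r a.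
Proof. by apply/ffunP=> q; rewrite !(updE, ffunE) (inj_eq enum_val_inj). Qed.

Lemma restr_upd_out K x i a : i \notin K -> restr K (upd x i a) = restr K x.
Proof.
move=> nKi; apply: eq_restr => j Kj; rewrite updE; case: eqP => // ji.
by rewrite -ji Kj in nKi.
Qed.

End Blocks.

(** * Parity of Boolean vectors *)

Lemma addb_sum_out (k : nat) (F G : 'I_k -> bool) j :
  (forall l, l != j -> F l = G l) ->
  \big[addb/false]_(l < k) F l (+) \big[addb/false]_(l < k) G l = F j (+) G j.
Proof.
move=> FG; rewrite (bigD1 j) //= [X in _ (+) X](bigD1 j) //=.
rewrite (eq_bigr _ FG).
by case: (F j); case: (G j); case: (\big[_/_]_(_ | _) _).
Qed.

Definition toggle k (v : {ffun 'I_k -> bool}) j : {ffun 'I_k -> bool} :=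
  [ffun l => (l == j) (+) v l].

Lemma toggleK k j : involutive (fun v : {ffun 'I_k -> bool} => toggle v j).
Proof. by move=> v; apply/ffunP=> l; rewrite !ffunE addKb. Qed.

Lemma bool_vector_ind k (P : {ffun 'I_k -> bool} -> Prop) v :
  P v -> (forall w j, P w -> P (toggle w j)) -> forall w, P w.
Proof.
move=> Pv IH w.
pose g (t : seq 'I_k) : {ffun 'I_k -> bool} := [ffun l => if l \in t then w l else v l].
have -> : w = g (enum 'I_k) by apply/ffunP=> l; rewrite ffunE mem_enum.
elim: (enum 'I_k) => [|j t Pt].
  by have -> : g [::] = v by apply/ffunP=> l; rewrite ffunE.
have [wj|nwj] := eqVneq (w j) (g t j).
  have -> // : g (j :: t) = g t.
  by apply/ffunP=> l; rewrite !ffunE inE; case: eqP => //= ->; rewrite {1}wj ffunE.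
have -> : g (j :: t) = toggle (g t) j; last exact: IH.
apply/ffunP=> l; rewrite [RHS]ffunE; case: (eqVneq l j) => [->|nlj] /=.
  by rewrite ffunE inE eqxx /=; move: nwj; case: (w j); case: (g t j).
by rewrite !ffunE inE (negbTE nlj).
Qed.

(** Toggling coordinate 0 exchanges the two parities, so each has half of the vectors. *)
Lemma card_parity (k : nat) (c : bool) : 0 < k ->
  #|[set v : {ffun 'I_k -> bool} | \big[addb/false]_(j < k) v j == c]| = 2 ^ k.-1.
Proof.
case: k => // k _ /=.
pose E b := [set v : {ffun 'I_k.+1 -> bool} | \big[addb/false]_(j < k.+1) v j == b].
have Eg b : #|E b| = #|E (~~ b)|.
  rewrite -(card_imset (E b) (inv_inj (toggleK ord0))) (can_imset_pre _ (toggleK ord0)).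
  apply: eq_card => v; rewrite !inE.
  have := @addb_sum_out k.+1 (toggle v ord0) v ord0.
  rewrite ffunE eqxx addTb addNb addbb.
  have H l : l != ord0 -> toggle v ord0 l = v l by rewrite ffunE => /negbTE->.
  by move/(_ H); case: (\big[_/_]_(_ < _) _); case: (\big[_/_]_(_ < _) _); case: (b).
have EC : E (~~ c) = ~: E c.
  by apply/setP=> v; rewrite !inE; case: (\big[_/_]_(_ < _) _); case: (c).
have := cardsC (E c); rewrite -EC -Eg card_ffun card_bool card_ord expnS mul2n addnn.
by move/double_inj.
Qed.

(** * Decompositions into connected blocks *)

(** A [representation] without the bounds on [k], primality and the normalization at zero. In this
    form it passes to the complement of [S] with the same codes and the opposite [s]. *)
Definition decomposition n (S : {set word 'I_n}) k (K : 'I_k -> {set 'I_n})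
    (Sc : forall j, {set word 'I_#|K j|}) (s : bool) : Prop :=
  ord_partition K /\ forall x,
    (x \in S) = (\big[addb/false]_(j < k) (restr (K j) x \in Sc j)) (+) s.

Lemma ord_partition_notin n k (K : 'I_k -> {set 'I_n}) i j l :
  ord_partition K -> i \in K j -> l != j -> i \notin K l.
Proof.
by case=> _ dK _ Kji nlj; have /pred0P/(_ i) /= := dK l j nlj; rewrite Kji andbT => ->.
Qed.

Lemma ord_partition_inj n k (K : 'I_k -> {set 'I_n}) :
  ord_partition K -> injective K.
Proof.
move=> oK j l Kjl; have [nK _ _] := oK; have /set0Pn[i Kji] := nK j.
apply/eqP; apply: contraT => njl; rewrite eq_sym in njl.
by have := ord_partition_notin oK Kji njl; rewrite -Kjl Kji.
Qed.

Section Decomposition.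
Context (n k : nat) (S : {set word 'I_n}) (K : 'I_k -> {set 'I_n}).
Context (Sc : forall j, {set word 'I_#|K j|}) (s : bool).
Context (dec : decomposition S Sc s).
Implicit Types (x y z : word 'I_n) (i : 'I_n) (j l : 'I_k).

(** The summands of all blocks other than [K j] cancel. *)
Lemma decomposition_upd x i a j : i \in K j ->
  (upd x i a \in S) (+) (x \in S) =
  (restr (K j) (upd x i a) \in Sc j) (+) (restr (K j) x \in Sc j).
Proof.
case: dec => oK E Kji; rewrite -(addb_sum_out (j := j) (F := fun l =>
  restr (K l) (upd x i a) \in Sc l) (G := fun l => restr (K l) x \in Sc l)).
  by rewrite !E addbACA addbb addbF.
by move=> l nlj; rewrite restr_upd_out //; apply: ord_partition_notin oK Kji nlj.
Qed.

Lemma conn_restr j x y : conn S x y -> conn (Sc j) (restr (K j) x) (restr (K j) y).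
Proof.
apply: connect_homo => {}x {}y /linkP[i [a [-> Sxy]]].
case: (boolP (i \in K j)) => Kji; last by rewrite restr_upd_out // connect0.
have := decomposition_upd x a Kji; rewrite -Sxy addbb.
have [r ->] := enum_val_surj Kji; rewrite restr_upd_in => E.
by apply: conn_upd; move: E; do 2!case: (_ \in _).
Qed.

Lemma conn_glue j u v z : conn (Sc j) u v -> conn S (glue u z) (glue v z).
Proof.
apply: (connect_homo (g := fun u => glue u z)) => {}u {}v /linkP[r [a [-> Suv]]].
rewrite glue_upd; apply: conn_upd.
have := decomposition_upd (glue u z) a (enum_valP r).
by rewrite -glue_upd !restr_glue -Suv addbb; do 2!case: (_ \in _).
Qed.

Lemma glue_mem j u v z :
  (glue u z \in S) (+) (glue v z \in S) = (u \in Sc j) (+) (v \in Sc j).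
Proof.
apply: (@word_ind_on _ setT (fun u => (glue u z \in S) (+) (glue v z \in S) =
  (u \in Sc j) (+) (v \in Sc j)) v) => [|w r a _ wE|r]; rewrite ?inE ?addbb //.
have := decomposition_upd (glue w z) a (enum_valP r).
rewrite -glue_upd !restr_glue => E; move: wE E.
by do 3!case: (_ \in S); do 3!case: (_ \in Sc j).
Qed.

Context (mSc : forall j, double_MDS (Sc j)).
Context (pSc : forall j, prime_code (Sc j)).

Lemma block_inhabited j : exists r : 'I_#|K j|, True.
Proof.
case: dec => -[nK _ _] _; have /set0Pn[i Ki] := nK j.
by have [r _] := enum_val_surj Ki; exists r.
Qed.

Lemma block_conn j x y : (forall i, i \notin K j -> x i = y i) ->
  (restr (K j) x \in Sc j) = (restr (K j) y \in Sc j) -> conn S x y.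
Proof.
move=> xy cxy; rewrite -(glue_restr (K := K j) (x := x) (y := x) (z := x)) //.
rewrite -[y](glue_restr (K := K j) (x := y) (y := y) (z := x)) //.
have [r _] := block_inhabited j.
exact: conn_glue (prime_conn_color r (@mSc j) (pSc j) cxy).
Qed.

(** Paths project to each block, which gives one direction. Conversely the blocks of [x] are
    replaced by those of [y] one at a time; each replacement keeps the class, since a prime block
    code and its complement are connected. *)
Lemma decomposition_connP x y :
  conn S x y <-> forall j, (restr (K j) x \in Sc j) = (restr (K j) y \in Sc j).
Proof.
split=> [xy j|cxy]; first exact/conn_mem/conn_restr.
case: (dec) => oK _; have [_ _ coverK] := oK.
(* [w t] agrees with [y] on the blocks listed in [t] and with [x] elsewhere. *)
pose w (t : seq 'I_k) : word 'I_n :=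
  [ffun i => if has (fun j => i \in K j) t then y i else x i].
have wout t j i : i \in K j -> w t i = if j \in t then y i else x i.
  move=> Kji; rewrite ffunE; congr (if _ then _ else _).
  apply/hasP/idP => [[l tl Kli]|tj]; last by exists j.
  suff /eqP <- : l == j by [].
  by apply: contraTT Kli => nlj; apply: ord_partition_notin oK Kji nlj.
have -> : y = w (enum 'I_k).
  apply/ffunP=> i; have [j Kji] := coverK i.
  by rewrite (wout _ j) // mem_enum.
elim: (enum 'I_k) => [|j t IHt].
  have -> : w [::] = x by apply/ffunP=> i; rewrite ffunE.
  exact: conn_refl.
apply: conn_trans IHt _; apply: (@block_conn j) => [i nKji|].
  by rewrite !ffunE /= (negbTE nKji).
have wE t' : restr (K j) (w t') = if j \in t' then restr (K j) y else restr (K j) x.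
  by case: ifP => tj; apply: eq_restr => i Kji; rewrite (wout _ j) // tj.
by rewrite !wE inE eqxx /=; case: ifP.
Qed.

Context (mS : double_MDS S).

(** [tau S i] flips the colour of the block of [i] and of no other block, and block colours
    determine the class. The blocks can therefore be read off from [S] alone. *)
Lemma decomposition_equiflip i i' j : i \in K j -> equiflip S i i' = (i' \in K j).
Proof.
move=> Kji; apply/idP/idP => [/equiflipP si|Kji'].
  apply: contraT => nKji'; pose x := zero_word n.
  have /decomposition_connP/(_ j) := si x.
  have [[a xa] [b xb]] := (tauE S i x, tauE S i' x).
  have := decomposition_upd x a Kji; rewrite -xa tau_mem // => E.
  move: E; rewrite xb restr_upd_out // => E F; move: E; rewrite F.
  by case: (_ \in _); case: (_ \in _).
apply/equiflipP=> x; have [[a xa] [b xb]] := (tauE S i x, tauE S i' x).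
apply: (@block_conn j) => [l nKjl|].
  by rewrite !tau_out //; [move: Kji' | move: Kji] => Kj;
    apply: contraNneq nKjl => ->.
have := decomposition_upd x a Kji; have := decomposition_upd x b Kji'.
rewrite -xa -xb !tau_mem // => ->.
by do 3!case: (_ \in Sc j).
Qed.

Definition colors x : {ffun 'I_k -> bool} := [ffun j => restr (K j) x \in Sc j].

Lemma decomposition_component x : x \in S ->
  component S x = [set y | colors y == colors x].
Proof.
move=> Sx; apply/setP=> y; rewrite mem_component // inE eq_sym.
apply/idP/eqP => [/decomposition_connP cxy|/ffunP cxy].
  by apply/ffunP=> j; rewrite !ffunE.
by apply/decomposition_connP=> j; move: (cxy j); rewrite !ffunE.
Qed.

Lemma colors_upd x i j : i \in K j -> exists a, colors (upd x i a) = toggle (colors x) j.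
Proof.
move=> Kji; have [a xa] := tauE S i x; exists a; apply/ffunP=> l; rewrite !ffunE.
have [->|nlj] := eqVneq l j; last first.
  by rewrite restr_upd_out //; case: dec => oK _; apply: ord_partition_notin oK Kji nlj.
have := decomposition_upd x a Kji; rewrite -xa tau_mem //.
by case: (_ \in _); case: (_ \in _); case: (_ \in _).
Qed.

Lemma colors_surj v : exists x, colors x = v.
Proof.
apply: (@bool_vector_ind k (fun v => exists x, colors x = v) (colors (zero_word n))).
  by exists (zero_word n).
move=> w j [x <-]; have [r _] := block_inhabited j.
by have [a xa] := colors_upd x (enum_valP r); eexists; apply: xa.
Qed.

(** It suffices to compare two vectors that differ by one toggle, at block [j]. Every line in a
    direction of that block meets both fibres in two words or neither of them. *)
Lemma card_colors v w : #|[set x | colors x == v]| = #|[set x | colors x == w]|.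
Proof.
move: w; apply: (@bool_vector_ind k (fun w =>
  #|[set x | colors x == v]| = #|[set x | colors x == w]|) v) => // w j ->.
have [r _] := block_inhabited j; pose i := enum_val r.
(* Along this line only the colour of block [j] varies, and it takes each value twice. *)
have half x u : colors x = u \/ colors x = toggle u j ->
    #|line x i :&: [set y | colors y == u]| = 2.
  move=> xu; rewrite card_line_setI.
  rewrite -[RHS](double_MDS_color (u j) (restr (K j) x) r (@mSc j)).
  apply: eq_card => a; rewrite !inE -restr_upd_in; apply/eqP/eqP => [<-|E].
    by rewrite ffunE.
  apply/ffunP=> l; rewrite ffunE; have [-> //|nlj] := eqVneq l j.
  rewrite restr_upd_out; last first.
    by case: dec => oK _; apply: ord_partition_notin oK (enum_valP r) nlj.
  by case: xu => /ffunP/(_ l); rewrite !ffunE ?(negbTE nlj).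
have none x u : ~ (colors x = u \/ colors x = toggle u j) ->
    #|line x i :&: [set y | colors y == u]| = 0.
  move=> xu; apply/eqP; rewrite cards_eq0; apply/eqP/setP=> y; rewrite in_set0.
  apply/negP=> /setIP[/mem_lineP[a ->]]; rewrite inE => /eqP E; apply: xu.
  have [cj|ncj] := eqVneq (u j) (colors x j); [left | right];
    apply/ffunP=> l; move/ffunP/(_ l): E; rewrite !ffunE.
    have [->|nlj] := eqVneq l j; first by rewrite cj ffunE.
    by rewrite restr_upd_out // (ord_partition_notin _ (enum_valP r) nlj) //; case: dec.
  have [->|nlj] := eqVneq l j.
    by move=> _; move: ncj; rewrite ffunE /=; case: (u j); case: (_ \in _).
  by rewrite restr_upd_out // (ord_partition_notin _ (enum_valP r) nlj) //; case: dec.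
apply: (@eq_card_lines _ _ _ i) => x.
have [e|] := boolP ((colors x == w) || (colors x == toggle w j)).
  by case/orP: e => /eqP E; rewrite !half // ?toggleK; auto.
by case/norP=> /eqP n1 /eqP n2; rewrite !none // ?toggleK => -[].
Qed.

(** The components of [S] are the fibres of [colors] over the vectors of parity [~~ s]. *)
Lemma decomposition_components : 0 < k -> equal_components S (2 ^ k.-1).
Proof.
move=> k0; split; last first.
  move=> _ _ /imsetP[x Sx ->] /imsetP[y Sy ->].
  by rewrite !decomposition_component //; apply: card_colors.
pose fib v := [set y | colors y == v].
have fib_inj : injective fib.
  move=> v w /setP vw; have [x xv] := colors_surj v.
  by move: (vw x); rewrite !inE xv eqxx => /esym/eqP.
rewrite -(card_parity (~~ s) k0) -(card_imset _ fib_inj).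
have memE x : (x \in S) = (\big[addb/false]_(j < k) colors x j) (+) s.
  by case: dec => _ ->; congr (_ (+) _); apply: eq_bigr => j _; rewrite ffunE.
apply: eq_card => C; apply/imsetP/imsetP => [[x Sx ->]|[v]].
  exists (colors x); last exact: decomposition_component.
  by rewrite inE; move: Sx; rewrite memE; case: (\big[_/_]_(_ < _) _); case: (s).
have [x <-] := colors_surj v; rewrite inE => vs ->; exists x.
  by rewrite memE; move: vs; case: (\big[_/_]_(_ < _) _); case: (s).
by rewrite decomposition_component // memE; move: vs;
  case: (\big[_/_]_(_ < _) _); case: (s).
Qed.

Lemma decomposition_prime_split : 0 < k -> prime_split S (2 ^ k.-1).
Proof.
case/decomposition_components=> cS eqS; exists (components S); split=> //.
  exact: components_partition.
by move=> _ /imsetP[x Sx ->]; apply: prime_component.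
Qed.

(** With a suitable [z] outside the block, [glue u z] embeds the words of colour [c] into [S] and
    preserves adjacency, so a 2-colouring of [G(S)] pulls back. *)
Lemma decomposition_bipartite_color (c : bool) j : 1 < k -> bipartite S ->
  exists f : word 'I_#|K j| -> bool, forall u v,
    (u \in Sc j) = c -> (v \in Sc j) = c -> adjacent u v -> f u != f v.
Proof.
move=> k1 [f fS].
have [l nlj] : exists l : 'I_k, l != j.
  have /card_gt0P[l] : 0 < #|predC1 j| by rewrite cardC1 card_ord -subn1 subn_gt0.
  by exists l.
have [z zE] : exists z, forall u, (glue u z \in S) = ((u \in Sc j) == c).
  have all_u z : (glue (zero_word #|K j|) z \in S) = ((zero_word #|K j| \in Sc j) == c) ->
      forall u, (glue u z \in S) = ((u \in Sc j) == c).
    move=> z0 u; have := glue_mem u (zero_word #|K j|) z; rewrite z0.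
    by case: (_ \in S); case: (_ \in Sc j); case: (_ \in Sc j); case: (c).
  pose z0 := zero_word n; pose u0 := zero_word #|K j|.
  have [E|nE] := eqVneq (glue u0 z0 \in S) ((u0 \in Sc j) == c).
    by exists z0; apply: all_u.
  (* Zeros outside the block give the wrong parity; a flip inside another block [l] corrects it
     without touching block [j]. *)
  have [r _] := block_inhabited l; pose i := enum_val r.
  have nKji : i \notin K j.
    by case: dec => oK _; apply: ord_partition_notin oK (enum_valP r) _; rewrite eq_sym.
  exists (tau S i (glue u0 z0)); apply: all_u.
  have -> : glue (zero_word #|K j|) (tau S i (glue u0 z0)) = tau S i (glue u0 z0).
    rewrite -[X in glue X _](restr_glue u0 z0); apply: glue_restr => // q Kjq.
    by rewrite tau_out //; apply: contraNneq nKji => <-.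
  by rewrite tau_mem // -/u0; move: nE; case: (_ \in S); case: (_ == c).
exists (fun u => f (glue u z)) => u v uc vc /adjacentP[r [a [nar vE]]].
apply: fS; rewrite ?zE ?uc ?vc ?eqxx //.
apply/adjacentP; exists (enum_val r), a; rewrite glue_in; split=> //.
by rewrite vE glue_upd.
Qed.

Lemma decomposition_bipartite j : 1 < k -> bipartite S ->
  bipartite (Sc j) /\ bipartite (~: Sc j).
Proof.
move=> k1 bS; split.
  by have [f fE] := decomposition_bipartite_color true j k1 bS; exists f.
have [f fE] := decomposition_bipartite_color false j k1 bS; exists f => u v.
by rewrite !inE => /negbTE uS /negbTE vS; apply: fE.
Qed.

End Decomposition.

(** * Existence and uniqueness *)

Section Canonical.
Context (n : nat) (S : {set word 'I_n}).

Lemma restr_zero (K : {set 'I_n}) : restr K (zero_word n) = zero_word #|K|.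
Proof. by apply/ffunP=> r; rewrite !ffunE. Qed.

Lemma glue_zero (K : {set 'I_n}) : glue (zero_word #|K|) (zero_word n) = zero_word n.
Proof. by rewrite -restr_zero; apply: glue_restr. Qed.

(** The slice of [S] through zero along [K], complemented when zero is not in [S], so that it always
    contains the zero word. *)
Definition block_code (K : {set 'I_n}) : {set word 'I_#|K|} :=
  [set u | (glue u (zero_word n) \in S) == (zero_word n \in S)].

Lemma decomposition_setC k (K : 'I_k -> {set 'I_n})
    (Sc : forall j, {set word 'I_#|K j|}) s :
  decomposition S Sc s -> decomposition (~: S) Sc (~~ s).
Proof. by case=> oK E; split=> // x; rewrite inE E addbN. Qed.

(** By [glue_mem] the code is determined by [S] up to complement, and containing zero settles which
    of the two it is. *)
Lemma decomposition_block_code k (K : 'I_k -> {set 'I_n})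
    (Sc : forall j, {set word 'I_#|K j|}) s j :
  decomposition S Sc s -> zero_word #|K j| \in Sc j -> Sc j = block_code (K j).
Proof.
move=> dec S0; apply/setP=> u; rewrite inE.
have := glue_mem dec u (zero_word #|K j|) (zero_word n); rewrite glue_zero S0.
by case: (_ \in S); case: (_ \in S); case: (_ \in Sc j).
Qed.

Lemma decomposition_sign k (K : 'I_k -> {set 'I_n})
    (Sc : forall j, {set word 'I_#|K j|}) s :
  decomposition S Sc s -> (forall j, zero_word #|K j| \in Sc j) ->
  s = (zero_word n \in S) (+) \big[addb/false]_(j < k) true.
Proof.
case=> _ E S0; rewrite E (eq_bigr (fun=> true)) => [|j _]; last by rewrite restr_zero S0.
by rewrite addbC addKb.
Qed.

Context (mS : double_MDS S).

Lemma double_MDS_block_code (K : {set 'I_n}) : double_MDS (block_code K).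
Proof.
apply/double_MDSP=> u r; rewrite -[RHS](double_MDS_color (zero_word n \in S)
  (glue u (zero_word n)) (enum_val r) mS).
by apply: eq_card => a; rewrite !inE glue_upd.
Qed.

Lemma conn_block (K : {set 'I_n}) i0 (x y : word 'I_n) : i0 \in K ->
  {in K, forall i, equiflip S i i0} ->
  (forall i, i \notin K -> y i = x i) ->
  (x \in S) = (y \in S) -> conn S x y.
Proof.
move=> Ki0 eK yx Sxy.
(* Invariant of the walk from [x] inside [K]: each colour change applies the one involution shared
   by all directions of [K], so the colour of the current word tells whether its class is that of
   [x] or of [tau S i0 x]. *)
suff H : conn S (if (x \in S) == (y \in S) then x else tau S i0 x) y.
  by rewrite Sxy eqxx in H.
apply: (@word_ind_on _ K (fun y =>
  conn S (if (x \in S) == (y \in S) then x else tau S i0 x) y) x) => //.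
  by rewrite eqxx conn_refl.
move=> z i a Ki xz; have [Sa|nSa] := eqVneq (upd z i a \in S) (z \in S).
  by rewrite Sa; apply: conn_trans xz (conn_upd Sa).
have {}nSa : (upd z i a \in S) = (z \notin S) by move: nSa; do 2!case: (_ \in S).
apply: conn_trans (conn_tau_upd mS nSa); rewrite conn_sym.
apply: conn_trans (equiflipP _ _ _ (eK i Ki) z) _; rewrite conn_sym.
have := conn_tau i0 mS xz; rewrite nSa.
have -> : ((x \in S) == (z \notin S)) = ((x \in S) != (z \in S)).
  by do 2!case: (_ \in S).
case: eqP => //= _; apply: conn_trans; rewrite conn_sym; exact: tauK.
Qed.

End Canonical.

Section Existence.
Context (n : nat) (S : {set word 'I_n}).
Context (mS : double_MDS S).

Definition flip_class (i : 'I_n) : {set 'I_n} := [set i' | equiflip S i i'].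

Definition flip_classes : {set {set 'I_n}} := [set flip_class i | i : 'I_n].

Definition flip_block (j : 'I_#|flip_classes|) : {set 'I_n} := enum_val j.

Lemma flip_blockP j i : i \in flip_block j -> flip_block j = flip_class i.
Proof.
rewrite /flip_block; have /imsetP[i0 _ ->] := enum_valP j; rewrite inE => i0i.
apply/setP=> l; rewrite !inE; apply/idP/idP; last exact: equiflip_trans.
by apply: equiflip_trans; rewrite equiflip_sym.
Qed.

Lemma flip_block_ord_partition : ord_partition flip_block.
Proof.
split=> [j|j l njl|i].
- have /imsetP[i _ Ei] := enum_valP j; apply/set0Pn; exists i.
  by rewrite /flip_block Ei inE equiflip_refl.
- apply/pred0P=> i /=; apply: contraNF njl => /andP[ij il]; apply/eqP.
  by apply: enum_val_inj; rewrite -!/(flip_block _) (flip_blockP ij) (flip_blockP il).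
have Pi : flip_class i \in flip_classes by apply: imset_f.
exists (enum_rank_in Pi (flip_class i)).
by rewrite /flip_block enum_rankK_in // inE equiflip_refl.
Qed.

(** The value forced at the zero word, where every block summand is [true]. *)
Definition flip_sign : bool :=
  (zero_word n \in S) (+) \big[addb/false]_(j < #|flip_classes|) true.

(** The sum of the two sides is constant, since a one-letter change alters both equally. *)
Lemma flip_decomposition :
  decomposition S (fun j => block_code S (flip_block j)) flip_sign.
Proof.
have oK := flip_block_ord_partition; have [_ _ coverK] := oK.
split=> // x; pose F y := \big[addb/false]_(j < #|flip_classes|)
  (restr (flip_block j) y \in block_code S (flip_block j)).
suff E : (x \in S) (+) F x = flip_sign by rewrite -E addbC addbK.
apply: (@word_ind_on _ setT (fun y => (y \in S) (+) F y = flip_sign) (zero_word n)).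
- rewrite /flip_sign; congr (_ (+) _); apply: eq_bigr => j _.
  by rewrite restr_zero inE glue_zero eqxx.
- move=> y i a _ <-; have [j ij] := coverK i; rewrite /F.
  pose G z l := restr (flip_block l) z \in block_code S (flip_block l).
  have E : (\big[addb/false]_l G (upd y i a) l) (+) \big[addb/false]_l G y l =
      G (upd y i a) j (+) G y j.
    apply: addb_sum_out => l nlj; rewrite /G restr_upd_out //.
    exact: ord_partition_notin oK ij nlj.
  have [r ir] := enum_val_surj ij.
  have D : (upd y i a \in S) (+) (y \in S) = G (upd y i a) j (+) G y j.
    rewrite /G ir restr_upd_in !inE glue_upd -ir.
    (* The block of [i] is its [equiflip] class, so the letters outside it may be set to zero
       without affecting the change of colour. *)
    rewrite (@derivative_equiflip _ S i y (glue (restr (flip_block j) y) (zero_word n))) //.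
      by do 3!case: (_ \in S).
    move=> l il; have : l \in flip_block j by rewrite (flip_blockP ij) inE.
    by case/enum_val_surj=> q ->; rewrite glue_in ffunE.
  move: E D; rewrite -/(G _ _) => E; rewrite -{}E.
  by do 2!case: (\big[_/_]_(_ < _) _); do 2!case: (_ \in S).
by move=> i; rewrite inE.
Qed.

Lemma flip_representation : 0 < n ->
  representation S (fun j => block_code S (flip_block j)) flip_sign.
Proof.
move=> n0; have oK := flip_block_ord_partition; have [nK _ _] := oK.
have dec := flip_decomposition.
have zS (K : {set 'I_n}) : zero_word #|K| \in block_code S K by rewrite inE glue_zero.
have mSc := double_MDS_block_code mS.
split=> //; last by case: dec.
- apply/andP; split; last by rewrite -[X in _ <= X]card_ord; apply: leq_imset_card.
  by apply/card_gt0P; exists (flip_class (Ordinal n0)); apply: imset_f.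
- move=> j; split; first exact: mSc.
  have /set0Pn[i0 ji0] := nK j.
  (* The extensions of [u] and zero by zeros have the same colour, so [conn_block] joins them, and
     [conn_restr] projects the path to the block. *)
  apply: (@conn_prime _ _ (zero_word _)) => // u; rewrite inE => /eqP Su.
  rewrite -[u](restr_glue u (zero_word n)) -restr_zero.
  apply: (conn_restr dec j); apply: (conn_block mS ji0) => //.
    by move=> i; rewrite (flip_blockP ji0) inE equiflip_sym.
  by move=> i nji; rewrite glue_out.
Qed.

End Existence.

(** * Uniqueness of the representation, and the theorem *)

Lemma representation_decomposition n (S : {set word 'I_n}) k
    (K : 'I_k -> {set 'I_n}) (Sc : forall j, {set word 'I_#|K j|}) s :
  representation S Sc s -> decomposition S Sc s.
Proof. by case. Qed.

(** In both representations the block of a coordinate [i] is the [equiflip] class of [i]. *)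
Lemma representation_block n (S : {set word 'I_n}) k k'
    (K : 'I_k -> {set 'I_n}) (Sc : forall j, {set word 'I_#|K j|}) s
    (K' : 'I_k' -> {set 'I_n}) (Sc' : forall j, {set word 'I_#|K' j|}) s' :
  double_MDS S -> representation S Sc s -> representation S Sc' s' ->
  forall j, exists j', K' j' = K j.
Proof.
move=> mS rep rep' j.
have [dec dec'] := (representation_decomposition rep, representation_decomposition rep').
have [[_ [nK _ _] pSc _ _] [_ [_ _ cK'] pSc' _ _]] := (rep, rep').
have /set0Pn[i ij] := nK j; have [j' ij'] := cK' i; exists j'.
apply/setP=> l.
rewrite -(decomposition_equiflip dec' _ _ mS l ij'); try by move=> q; case: (pSc' q).
by rewrite (decomposition_equiflip dec _ _ mS l ij) // => q; case: (pSc q).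
Qed.

(** The codes live in types that depend on their blocks, hence the comparison of dependent pairs.
    Both codes are the [block_code] of the same block. *)
Lemma representation_unique n (S : {set word 'I_n}) k k'
    (K : 'I_k -> {set 'I_n}) (Sc : forall j, {set word 'I_#|K j|}) s
    (K' : 'I_k' -> {set 'I_n}) (Sc' : forall j, {set word 'I_#|K' j|}) s' :
  double_MDS S -> representation S Sc s -> representation S Sc' s' ->
  [/\ k' = k, s' = s & exists p : 'I_k -> 'I_k', bijective p /\
     forall j : 'I_k, K' (p j) = K j /\
       existT (fun m => {set word 'I_m}) #|K' (p j)| (Sc' (p j)) =
       existT (fun m => {set word 'I_m}) #|K j| (Sc j)].
Proof.
move=> mS rep rep'.
have [dec dec'] := (representation_decomposition rep, representation_decomposition rep').
have [[_ oK _ zS _] [_ oK' _ zS' _]] := (rep, rep').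
have [p pE] := fin_all_exists (representation_block mS rep rep').
have [q qE] := fin_all_exists (representation_block mS rep' rep).
have bp : bijective p.
  (* Matching blocks in both directions gives mutually inverse maps, because distinct indices carry
     distinct blocks. *)
  exists q => j; [apply: (ord_partition_inj oK) | apply: (ord_partition_inj oK')].
    by rewrite qE pE.
  by rewrite pE qE.
have kk : k' = k by have := bij_eq_card bp; rewrite !card_ord.
split=> //.
  by rewrite (decomposition_sign dec zS) (decomposition_sign dec' zS') kk.
exists p; split=> // j; split=> //.
rewrite (decomposition_block_code dec (zS j)) (decomposition_block_code dec' (zS' (p j))).
by rewrite pE.
Qed.

Theorem theorem1 (n : nat) (S : {set word 'I_n}) :
  0 < n -> double_MDS S ->
  exists (k : nat) (K : 'I_k -> {set 'I_n})
         (Sc : forall j : 'I_k, {set word 'I_#|K j|}) (s : bool),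
    [/\ (* (a) existence *)
        representation S Sc s,
        (* (a) uniqueness *)
        (forall (k' : nat) (K' : 'I_k' -> {set 'I_n})
                (Sc' : forall j : 'I_k', {set word 'I_#|K' j|}) (s' : bool),
            representation S Sc' s' ->
            [/\ k' = k, s' = s &
              exists p : 'I_k -> 'I_k', bijective p /\
                forall j : 'I_k, K' (p j) = K j /\
                  existT (fun m => {set word 'I_m}) #|K' (p j)| (Sc' (p j)) =
                  existT (fun m => {set word 'I_m}) #|K j| (Sc j)]),
        (* (b) *)
        [/\ prime_split S (2 ^ k.-1), prime_split (~: S) (2 ^ k.-1),
            equal_components S (2 ^ k.-1) & equal_components (~: S) (2 ^ k.-1)] &
        (* (c) *)
        (2 <= k -> bipartite S ->
           forall j : 'I_k, bipartite (Sc j) /\ bipartite (~: Sc j))].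
Proof.
move=> n0 mS; have rep := flip_representation mS n0.
(* The complement of [S] has the same [k], blocks and codes, so (b) for it follows from the same
   lemmas. *)
have dec := representation_decomposition rep; have decC := decomposition_setC dec.
have mSC := double_MDS_setC mS.
have [/andP[k0 _] _ codes _ _] := rep.
have mSc j : double_MDS (block_code S (flip_block (S := S) j)) by case: (codes j).
have pSc j : prime_code (block_code S (flip_block (S := S) j)) by case: (codes j).
exists #|flip_classes S|, (@flip_block n S),
  (fun j => block_code S (flip_block j)), (flip_sign S).
split=> //.
- by move=> k' K' Sc' s'; apply: representation_unique.
- by split; [apply: decomposition_prime_split dec _ _ _ _
    | apply: decomposition_prime_split decC _ _ _ _
    | apply: decomposition_components dec _ _ _ _
    | apply: decomposition_components decC _ _ _ _].
- by move=> k1 bS j; apply: (decomposition_bipartite dec).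
Qed.
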